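(* (Wendroff's Theorem for (P)OPUC.) Let $n\ge 1$. If $\alpha_0,\dots,\alpha_{n-1}\in\mathbb{D}$ and $\lambda\ne\mu$ are in $\partial\mathbb{D}$, then the zeros of the POPUCs $\Phi_{n+1}(z;\lambda)$ and $\Phi_{n+1}(z;\mu)$ built from $\{\alpha_j\}_{j=0}^{n-1}$ interlace. Conversely, given two interlacing sets $Z$ and $W$ of $n+1$ points each on $\partial\mathbb{D}$, there exist unique $\{\alpha_j\}_{j=0}^{n-1}$ in $\mathbb{D}$ and unique $\lambda,\mu\in\partial\mathbb{D}$ such that $Z$ is the set of zeros of $\Phi_{n+1}(z;\lambda)$ and $W$ is the set of zeros of $\Phi_{n+1}(z;\mu)$.
   Context: $\mathbb{D}$ is the open unit disk. For a polynomial $P$ regarded as having degree $k$, $P^*(z)=z^k\overline{P(1/\bar z)}$. Given $\alpha_0,\dots,\alpha_{n-1}\in\mathbb{D}$ (Verblunsky coefficients), define monic polynomials by $\Phi_0=1$ and Szegő recursion $\Phi_{j+1}(z)=z\Phi_j(z)-\overline{\alpha_j}\,\Phi_j^*(z)$, $0\le j\le n-1$. For $\lambda\in\partial\mathbb{D}$, the paraorthogonal polynomial (POPUC) is $\Phi_{n+1}(z;\lambda)=z\Phi_n(z)-\bar\lambda\,\Phi_n^*(z)$; it has $n+1$ distinct zeros, all on $\partial\mathbb{D}$. Two sets of $n+1$ distinct points on $\partial\mathbb{D}$ (strictly) interlace if they are disjoint and each of the $n+1$ open arcs of $\partial\mathbb{D}$ obtained by removing one set contains exactly one point of the other set. *)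

(* Defs.v *)
From HB Require Import structures.
From mathcomp Require Import all_boot all_order all_algebra.
From mathcomp Require Import all_classical all_reals all_analysis.
From mathcomp Require Import complex.

Set Implicit Arguments.
Unset Strict Implicit.
Unset Printing Implicit Defensive.

Import Order.TTheory GRing.Theory Num.Theory.

Local Open Scope classical_set_scope.
Local Open Scope ring_scope.

(* P^*(z) = z^k \overline{P(1/\bar z)} for P regarded as having degree k, i.e.
   size P <= k.+1: the coefficients of P, padded with zeros up to degree k, are
   conjugated and listed in reverse order. *)
Definition revp (R : realType) (k : nat) (P : {poly R[i]}) : {poly R[i]} :=
  \poly_(i < k.+1) (P`_(k - i))^*.

Lemma horner_revp (R : realType) (k : nat) (P : {poly R[i]}) (z : R[i]) :
  (size P <= k.+1)%N -> z != 0 ->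
  (revp k P).[z] = z ^+ k * (P.[(z^*)^-1])^*.
Proof.
move=> sP z0; rewrite horner_poly (horner_coef_wide _ sP) rmorph_sum mulr_sumr.
rewrite (reindex_inj rev_ord_inj) /=; apply: eq_bigr => i _.
have ik : (i <= k)%N by rewrite -ltnS.
rewrite subSS subKn // rmorphM rmorphXn fmorphV /= conjCK exprVn.
by rewrite mulrCA exprB ?unitfE.
Qed.

(* The monic polynomials Phi_k; only a 0, ..., a k.-1 are used. *)
Fixpoint opuc (R : realType) (a : nat -> R[i]) (k : nat) : {poly R[i]} :=
  if k is j.+1 then 'X * opuc a j - (a j)^* *: revp j (opuc a j) else 1.

(* The paraorthogonal polynomial Phi_{n+1}(z; lam). *)
Definition popuc (R : realType) (n : nat) (alpha : n.-tuple R[i]) (lam : R[i]) :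
    {poly R[i]} :=
  let Phi := opuc (nth 0 alpha) n in 'X * Phi - lam^* *: revp n Phi.

Definition zeros (R : realType) (P : {poly R[i]}) : set R[i] :=
  [set z | root P z].

Definition in_disk (R : realType) (z : R[i]) : Prop := `|z| < 1.

Definition unit_circle (R : realType) : set R[i] := [set z | `|z| = 1].

Definition cis (R : realType) (t : R) : R[i] := (cos t +i* sin t)%C.

(* The open arc run through counterclockwise from a to b (for a = b it is the
   whole circle without a). *)
Definition open_arc (R : realType) (a b : R[i]) : set R[i] :=
  [set z | exists s t : R,
     [/\ 0 < t, t < s, s <= 2 * pi, b = a * cis s & z = a * cis t]].

(* The arcs obtained by removing a finite nonempty subset Z from the unit
   circle: those arcs with endpoints in Z that contain no point of Z. *)
Definition complementary_arc (R : realType) (Z A : set R[i]) : Prop :=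
  exists a b : R[i], [/\ Z a, Z b, A = open_arc a b & A `&` Z = set0].

(* Strict interlacing of two sets of N points.  Z is the set that is removed
   from the circle; as both sets have N points, removing W instead gives the
   same relation. *)
Definition interlace (R : realType) (N : nat) (Z W : set R[i]) : Prop :=
  [/\ Z `<=` @unit_circle R /\ W `<=` @unit_circle R,
      (Z #= `I_N)%card /\ (W #= `I_N)%card,
      Z `&` W = set0 &
      forall A : set R[i], complementary_arc Z A -> exists! w, (A `&` W) w].

(* Main.v *)
(* With u = z Phi_n and v = Phi_n^*, the Szego recursion gives |u| < |v| in the
   disk and u / v unimodular on the circle, so the zeros of u - lam^* v lie on
   the circle.  The Wronskian u' v - u v' divided by z^n is positive there, so
   u / v winds strictly monotonically and Rolle's theorem puts a zero of
   u - mu^* v between any two zeros of u - lam^* v.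

   Conversely let P, Q be the monic polynomials with zero sets Z, W.  Up to
   constants kP, kQ and a common factor they are on the circle the real functions
   \prod_j sin ((t - t_j) / 2).  By interlacing every real combination of P / kP
   and Q / kQ has a zero in each of the n + 1 arcs, hence no zero off the circle,
   so P kQ / (Q kP) is not real there.  Its values at 0 and at a zero of P - Q
   have imaginary parts of opposite signs; by connectedness P - Q has no zero in
   the closed disk.  It is a multiple of the wanted Phi_n^*, and the Schur-Cohn
   algorithm recovers the Verblunsky coefficients from Phi_n. *)
Require Import Defs.
From mathcomp Require Import all_boot all_order all_algebra.
From mathcomp Require Import all_classical all_reals all_analysis.
From mathcomp Require Import finmap separable complex ring lra.

Set Implicit Arguments.
Unset Strict Implicit.
Unset Printing Implicit Defensive.

Import Order.TTheory GRing.Theory Num.Theory numFieldNormedType.Exports.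

Local Open Scope classical_set_scope.
Local Open Scope ring_scope.

Local Notation Re := complex.Re.
Local Notation Im := complex.Im.

(** * Reversed polynomials and the Szego recursion *)

Section Reversal.
Variable R : realType.
Local Notation C := R[i].
Implicit Types (P Q : {poly C}) (z a : C) (k : nat).

Lemma coef_revp k P i : (revp k P)`_i = if (i <= k)%N then (P`_(k - i))^* else 0.
Proof. by rewrite coef_poly ltnS. Qed.

Lemma size_revp k P : (size (revp k P) <= k.+1)%N.
Proof. exact: size_poly. Qed.

Lemma revpD k P Q : revp k (P + Q) = revp k P + revp k Q.
Proof.
apply/polyP => i; rewrite coefD !coef_revp coefD.
by case: leqP => _; rewrite ?addr0 // rmorphD.
Qed.

Lemma revpZ k a P : revp k (a *: P) = a^* *: revp k P.
Proof.
apply/polyP => i; rewrite coefZ !coef_revp coefZ.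
by case: leqP => _; rewrite ?mulr0 // rmorphM.
Qed.

Lemma revpB k P Q : revp k (P - Q) = revp k P - revp k Q.
Proof. by rewrite -scaleN1r revpD revpZ rmorphN rmorph1 scaleN1r. Qed.

Lemma revpK k P : (size P <= k.+1)%N -> revp k (revp k P) = P.
Proof.
move=> sP; apply/polyP => i; rewrite !coef_revp leq_subr.
case: leqP => ik; first by rewrite subKn // conjCK.
by rewrite nth_default // (leq_trans sP).
Qed.

Lemma revpXM k P : revp k.+1 ('X * P) = revp k P.
Proof.
apply/polyP => i; rewrite !coef_revp coefXM.
case: (leqP i k) => ik; first by rewrite leqW // subSn.
case: leqP => // ik'; have -> : i = k.+1 by apply/eqP; rewrite eqn_leq ik ik'.
by rewrite subnn rmorph0.
Qed.

Lemma revpS k P : (size P <= k.+1)%N -> revp k.+1 P = 'X * revp k P.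
Proof.
move=> sP; apply/polyP => -[|i]; rewrite coefXM !coef_revp /=.
  by rewrite subn0 nth_default // rmorph0.
by rewrite subSS.
Qed.

Lemma revp_mulXsubC k a P : (size P <= k.+1)%N ->
  revp k.+1 (('X - a%:P) * P) = (1 - a^* *: 'X) * revp k P.
Proof.
move=> sP; rewrite mulrBl mul_polyC revpB revpXM revpZ revpS //.
by rewrite mulrBl mul1r -scalerAl.
Qed.

Lemma revp01 : revp 0 1 = 1 :> {poly C}.
Proof.
by apply/polyP => i; rewrite coef_revp !coef1; case: i => // *; rewrite rmorph1.
Qed.

Lemma opucS (a : nat -> C) k :
  opuc a k.+1 = 'X * opuc a k - (a k)^* *: revp k (opuc a k).
Proof. by []. Qed.

Lemma monic_size_mulX_revp k P a : P \is monic -> size P = k.+1 ->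
  let Q := 'X * P - a *: revp k P in Q \is monic /\ size Q = k.+2.
Proof.
move=> mP sP Q; have P0 : P != 0 by rewrite -size_poly_eq0 sP.
have sXP : size ('X * P) = k.+2 by rewrite mulrC size_mulX // sP.
have sl : (size (- (a *: revp k P)) < size ('X * P)%R)%N.
  by rewrite size_polyN sXP ltnS (leq_trans (size_scale_leq _ _)) ?size_revp.
split; last by rewrite size_polyDl.
by rewrite monicE lead_coefDl // lead_coefM lead_coefX mul1r -monicE.
Qed.

Lemma monic_size_opuc (a : nat -> C) k :
  opuc a k \is monic /\ size (opuc a k) = k.+1.
Proof.
elim: k => [|k [mk sk]]; first by rewrite monic1 size_poly1.
exact: monic_size_mulX_revp.
Qed.

Lemma monic_opuc (a : nat -> C) k : opuc a k \is monic.
Proof. by case: (monic_size_opuc a k). Qed.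

Lemma size_opuc (a : nat -> C) k : size (opuc a k) = k.+1.
Proof. by case: (monic_size_opuc a k). Qed.

Lemma eq_opuc (a b : nat -> C) k :
  (forall j, (j < k)%N -> a j = b j) -> opuc a k = opuc b k.
Proof.
elim: k => // k IH ab /=; rewrite IH ?ab // => j jk; exact/ab/ltnW.
Qed.

(** Reversal in degree k + 1 exchanges z Phi_k and Phi_k^*, which turns the Szego recursion into its
    companion. *)
Lemma revp_opucS (a : nat -> C) k :
  revp k.+1 (opuc a k.+1) = revp k (opuc a k) - a k *: ('X * opuc a k).
Proof.
rewrite opucS revpB revpXM revpZ conjCK revpS ?size_revp //.
by rewrite revpK ?size_opuc.
Qed.

Lemma revp_monic0 k P : P \is monic -> size P = k.+1 -> (revp k P).[0] = 1.
Proof.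
move=> /monicP; rewrite lead_coefE => + sP; rewrite sP /= => lP.
by rewrite horner_coef0 coef_revp /= subn0 lP rmorph1.
Qed.

Lemma opucS0 (a : nat -> C) k : (opuc a k.+1).[0] = - (a k)^*.
Proof.
rewrite opucS hornerD hornerN hornerZ revp_monic0 ?monic_opuc ?size_opuc //.
by rewrite hornerM hornerX mul0r sub0r mulr1.
Qed.

Lemma horner_revp_circle k P z : (size P <= k.+1)%N -> `|z| = 1 ->
  (revp k P).[z] = z ^+ k * (P.[z])^*.
Proof.
move=> sP z1; have z0 : z != 0 by rewrite -normr_eq0 z1 oner_eq0.
rewrite horner_revp //; congr (_ * (P.[_])^*).
by apply: invr_inj; rewrite invrK [RHS]invC_norm z1 expr1n invr1 mul1r.
Qed.

End Reversal.

(** * Comparison of Phi_k with its reversal in the closed disk *)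

Section Disk.
Variable R : realType.
Local Notation C := R[i].
Implicit Types (P Q : {poly C}) (z u v a : C) (k : nat).

(* The identity |v - a u|^2 - |u - a^* v|^2 = (1 - |a|^2) (|v|^2 - |u|^2). *)
Lemma ler_norm_szego a u v : `|a| < 1 -> `|u| <= `|v| ->
  `|u - a^* * v| <= `|v - a * u|.
Proof.
move=> a1 uv; rewrite -(ler_pXn2r (isT : 0 < 2)%N) ?nnegrE ?normr_ge0 //.
rewrite -subr_ge0 !normCK !rmorphB !rmorphM /= conjCK.
have -> : (v - a * u) * (v^* - a^* * u^*) - (u - a^* * v) * (u^* - a * v^*)
   = (1 - a * a^*) * (v * v^* - u * u^*) by ring.
rewrite -!normCK mulr_ge0 // subr_ge0; first by rewrite expr_le1 // ltW.
by rewrite ler_pXn2r ?nnegrE ?normr_ge0.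
Qed.

(** Both claims go through one induction: a zero of Phi_{k+1}^* = v - a u would give |v| = |a| |u|
    <= |a| |v|, hence v = 0, and the inequality is passed on by [ler_norm_szego]. *)
Lemma opuc_disk (a : nat -> C) k z :
  (forall j, (j < k)%N -> `|a j| < 1) -> `|z| <= 1 ->
  (revp k (opuc a k)).[z] != 0 /\ `|(opuc a k).[z]| <= `|(revp k (opuc a k)).[z]|.
Proof.
move=> + z1; elim: k => [|k IH] ak.
  by rewrite /= revp01 hornerC oner_eq0.
have [j jk|v0 uv] := IH; first exact/ak/ltnW.
have a1 := ak k (leqnn _).
rewrite revp_opucS opucS !(hornerD, hornerN, hornerZ, hornerM, hornerX).
set v := (revp _ _).[z] in v0 uv *; set u := z * _.
have {}uv : `|u| <= `|v|.
  by rewrite (le_trans _ uv) // normrM ler_piMl ?normr_ge0.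
split; last exact: ler_norm_szego.
apply: contraTneq (a1) => /eqP; rewrite subr_eq0 => /eqP vau.
have : `|v| * 1 <= `|v| * `|a k|.
  by rewrite mulr1 {1}vau normrM mulrC ler_wpM2r ?normr_ge0.
rewrite ler_pM2l ?normr_gt0 // => h; apply/negP.
by move=> /(le_lt_trans h); rewrite ltxx.
Qed.

End Disk.

Lemma card_eq_uniq_seqP (T : choiceType) (A : set T) N :
  (A #= `I_N)%card <-> exists s : seq T, [/\ uniq s, size s = N & A = [set` s]].
Proof.
split=> [AN|[s [us <- ->]]].
  exists (enum_fset (fset_set A)); split; [exact: fset_uniq| |].
    exact: card_fset_set.
  by rewrite fset_setK //; apply/finite_setP; exists N.
have -> : [set` s] = [set` [fset x in s]%fset] :> set T.
  by apply/seteqP; split=> x /=; rewrite inE.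
by apply/card_eq_fsetP; rewrite card_fseq undup_id.
Qed.

(** * Zeros of POPUCs: on the circle and simple *)

Section Zeros.
Variable R : realType.
Local Notation C := R[i].
Implicit Types (P Q : {poly C}) (z u v lam mu : C) (k : nat).

(** Over an algebraically closed field a polynomial none of whose zeros kills its derivative is
    separable, so its linear factors are distinct. *)
Lemma poly_circle_zeros P N : P \is monic -> size P = N.+1 ->
  (forall z, root P z -> `|z| = 1 /\ P^`().[z] != 0) ->
  exists s : seq C, [/\ uniq s, size s = N, P = \prod_(a <- s) ('X - a%:P)
    & {in s, forall z, `|z| = 1}].
Proof.
move=> mP sP rP; have [s] := closed_field_poly_normal P.
rewrite (monicP mP) scale1r => Ps; exists s; split=> //.
- rewrite -separable_prod_XsubC -Ps separable_poly.unlock.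
  by apply: Pdiv.ClosedField.root_coprimep => z /rP[].
- by apply: succn_inj; rewrite -sP Ps size_prod_XsubC.
- by move=> z zs; case: (rP z) => //; rewrite Ps root_prod_XsubC.
Qed.

Section Opuc.
Variables (a : nat -> C) (n : nat).
Hypothesis a_disk : forall j, (j < n)%N -> `|a j| < 1.
Local Notation u := ('X * opuc a n).
Local Notation v := (revp n (opuc a n)).

Lemma mulX_opuc_lt z : `|z| < 1 -> `|u.[z]| < `|v.[z]|.
Proof.
move=> z1; have [v0 uv] := opuc_disk a_disk (ltW z1).
rewrite hornerM hornerX normrM (le_lt_trans (ler_wpM2l (normr_ge0 _) uv)) //.
by rewrite gtr_pMl // normr_gt0.
Qed.

Lemma popuc_root_circle lam z : `|lam| = 1 ->
  root (u - lam^* *: v) z -> `|z| = 1.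
Proof.
move=> lam1; rewrite rootE !(hornerD, hornerN, hornerZ) subr_eq0 => /eqP uv.
have {}uv : `|u.[z]| = `|v.[z]| by rewrite uv normrM norm_conjC lam1 mul1r.
have [z1|z1|//] := real_ltgtP (normr_real z) (real1 _).
  by have := mulX_opuc_lt z1; rewrite uv ltxx.
have z0 : z != 0 by rewrite -normr_gt0 (lt_trans _ z1).
(* For |z| > 1 reflect in the circle: reversal exchanges the two moduli, so |u| = |v| at z becomes
   |z| |v(y)| = |Phi_n(y)| <= |v(y)|, a contradiction. *)
set y := (z^*)^-1.
have y1 : `|y| <= 1 by rewrite normfV norm_conjC invf_le1 ?normr_gt0 // ltW.
have [vy uvy] := opuc_disk a_disk y1.
have sv : (size v <= n.+1)%N by exact: size_revp.
move: uv; rewrite hornerM hornerX -{1}[opuc a n](@revpK _ n) ?size_opuc //.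
rewrite (horner_revp sv z0) (@horner_revp _ n (opuc a n) z) ?size_opuc //.
rewrite -/y !normrM !norm_conjC mulrCA.
move/(mulfI (_ : `|z ^+ n| != 0)); rewrite normr_eq0 expf_neq0 // => /(_ isT) E.
have : `|z| * `|v.[y]| <= 1 * `|v.[y]| by rewrite mul1r E.
by rewrite ler_pM2r ?normr_gt0 // => /(lt_le_trans z1); rewrite ltxx.
Qed.

End Opuc.

Local Notation U a n := ('X * opuc a n).
Local Notation V a n := (revp n (opuc a n)).

(* Christoffel-Darboux in disguise: on the circle W / z^n is
   \sum_(j <= n) |Phi_j|^2 times positive constants. *)
Lemma wronskian_gt0 (a : nat -> C) n z :
  (forall j, (j < n)%N -> `|a j| < 1) -> `|z| = 1 ->
  0 < ((U a n)^`() * V a n - U a n * (V a n)^`()).[z] / z ^+ n.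
Proof.
move=> + z1; have z0 : z != 0 by rewrite -normr_eq0 z1 oner_eq0.
elim: n => [|n IH] an.
  by rewrite /= revp01 !mulr1 derivX derivC mulr0 subr0 expr0 divr1 hornerC ltr01.
have {IH} := IH (fun j jn => an j (ltnW jn)).
have a1 := an n (leqnn _).
set u := U a n; set v := V a n; set u1 := U a n.+1; set v1 := V a n.+1 => W.
have Eu : u1 = 'X * (u - (a n)^*%:P * v) by rewrite mul_polyC.
have Ev : v1 = v - (a n)%:P * u by rewrite mul_polyC /v1 revp_opucS.
(* One recursion step multiplies the Wronskian by (1 - |a_n|^2) z and adds Phi_{n+1} Phi_{n+1}^*,
   which on the circle is z^(n+1) |Phi_{n+1}|^2. *)
have -> : u1^`() * v1 - u1 * v1^`() =
    opuc a n.+1 * v1 + (1 - a n * (a n)^*)%:P * ('X * (u^`() * v - u * v^`())).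
  have -> : opuc a n.+1 = u - (a n)^*%:P * v by rewrite mul_polyC.
  rewrite Eu Ev !(derivM, derivB, derivX, derivC) polyCB polyCM.
  by ring.
rewrite hornerD mulrDl ltr_wpDl //.
  rewrite hornerM /v1 horner_revp_circle ?size_opuc // mulrCA mulrAC.
  by rewrite mulfV ?expf_neq0 // mul1r -normCK exprn_ge0.
rewrite hornerM hornerC hornerM hornerX exprS -mulrA.
rewrite [_ / (z * _)](_ : _ = (u^`() * v - u * v^`()).[z] / z ^+ n).
  by rewrite mulr_gt0 // -normCK subr_gt0 exprn_ilt1.
by rewrite -mulf_div mulfV // mul1r.
Qed.

(** At a multiple zero u = lam^* v and u' = lam^* v', so the Wronskian would vanish. *)
Lemma popuc_deriv_neq0 (a : nat -> C) n lam z :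
  (forall j, (j < n)%N -> `|a j| < 1) -> `|z| = 1 ->
  let P := 'X * opuc a n - lam^* *: revp n (opuc a n) in
  root P z -> P^`().[z] != 0.
Proof.
move=> an z1 P; have := wronskian_gt0 an z1; rewrite {}/P.
move: (U a n) (V a n) => u v W Pz; apply: contraTN W => /eqP.
rewrite derivB derivZ !(hornerD, hornerN, hornerM, hornerZ) => E'.
move: Pz; rewrite rootE !(hornerD, hornerN, hornerZ) subr_eq0 => /eqP ->.
move/eqP: E'; rewrite subr_eq0 => /eqP ->.
by rewrite mulrAC subrr mul0r ltxx.
Qed.

Lemma popuc_zeros (a : nat -> C) n lam :
  (forall j, (j < n)%N -> `|a j| < 1) -> `|lam| = 1 ->
  exists s : seq C, [/\ uniq s, size s = n.+1,
    'X * opuc a n - lam^* *: revp n (opuc a n) = \prod_(z <- s) ('X - z%:P)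
    & {in s, forall z, `|z| = 1}].
Proof.
move=> an lam1.
have [m s] := monic_size_mulX_revp lam^* (monic_opuc a n) (size_opuc a n).
apply: poly_circle_zeros => // z Pz.
have z1 := popuc_root_circle an lam1 Pz; split=> //.
exact: popuc_deriv_neq0.
Qed.

End Zeros.

(** * Differentiation of complex-valued curves *)

Section ComplexCurves.
Variable R : realType.
Local Notation C := R[i].
Implicit Types (h k : R -> C) (t : R) (d e : C).

(* Taken on real and imaginary parts because [R[i]] is not a normed module
   over [R]. *)
Definition curve_derive h t d :=
  is_derive t 1 (fun x => Re (h x)) (Re d) /\
  is_derive t 1 (fun x => Im (h x)) (Im d).

Lemma RecD (x y : C) : Re (x + y) = Re x + Re y.
Proof. by case: x y => [? ?] [? ?]. Qed.

Lemma ImcD (x y : C) : Im (x + y) = Im x + Im y.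
Proof. by case: x y => [? ?] [? ?]. Qed.

Lemma RecM (x y : C) : Re (x * y) = Re x * Re y - Im x * Im y.
Proof. by case: x y => [? ?] [? ?]. Qed.

Lemma ImcM (x y : C) : Im (x * y) = Re x * Im y + Im x * Re y.
Proof. by case: x y => [? ?] [? ?]. Qed.

Lemma curve_derive_cst (c : C) t : curve_derive (fun=> c) t 0.
Proof. by split; apply: is_derive_cst. Qed.

Lemma curve_deriveD h k t d e : curve_derive h t d -> curve_derive k t e ->
  curve_derive (fun x => h x + k x) t (d + e).
Proof.
move=> [h1 h2] [k1 k2]; split.
  have -> : (fun x => Re (h x + k x)) =
      (fun x => Re (h x)) + (fun x => Re (k x)).
    by apply/funext => x /=; rewrite RecD.
  by rewrite RecD; apply: is_deriveD.
have -> : (fun x => Im (h x + k x)) = (fun x => Im (h x)) + (fun x => Im (k x)).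
  by apply/funext => x /=; rewrite ImcD.
by rewrite ImcD; apply: is_deriveD.
Qed.

Lemma curve_deriveM h k t d e : curve_derive h t d -> curve_derive k t e ->
  curve_derive (fun x => h x * k x) t (d * k t + h t * e).
Proof.
move=> [h1 h2] [k1 k2]; split.
  have -> : (fun x => Re (h x * k x)) =
      (fun x => Re (h x)) * (fun x => Re (k x)) -
      (fun x => Im (h x)) * (fun x => Im (k x)).
    by apply/funext => x /=; rewrite RecM.
  apply: (is_derive_eq (is_deriveB (is_deriveM h1 k1) (is_deriveM h2 k2))).
  by rewrite RecD !RecM /GRing.scale /=; ring.
have -> : (fun x => Im (h x * k x)) =
    (fun x => Re (h x)) * (fun x => Im (k x)) +
    (fun x => Im (h x)) * (fun x => Re (k x)).
  by apply/funext => x /=; rewrite ImcM.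
apply: (is_derive_eq (is_deriveD (is_deriveM h1 k2) (is_deriveM h2 k1))).
by rewrite ImcD !ImcM /GRing.scale /=; ring.
Qed.

Lemma curve_derive_conj h t d : curve_derive h t d ->
  curve_derive (fun x => (h x)^*) t d^*.
Proof.
move=> [h1 h2]; split.
  have -> : (fun x => Re (h x)^*) = (fun x => Re (h x)).
    by apply/funext => x; case: (h x).
  by case: d h1 {h2}.
have -> : (fun x => Im (h x)^*) = - (fun x => Im (h x)).
  by apply/funext => x; change (Im (h x)^* = - Im (h x)); case: (h x).
have -> : Im d^* = - Im d by case: d {h1 h2}.
exact: is_deriveN.
Qed.

Lemma curve_deriveV h t d : h t != 0 -> curve_derive h t d ->
  curve_derive (fun x => (h x)^-1) t (- d / h t ^+ 2).
Proof.
move=> h0 [h1 h2].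
(* [N] is |h|^2, so 1 / h is the conjugate of h over [N] and the real differentiation rules apply to
   its parts. *)
pose N x := Re (h x) ^+ 2 + Im (h x) ^+ 2.
have N0 : N t != 0.
  apply: contra_neq h0; rewrite /N => /eqP.
  rewrite paddr_eq0 ?sqr_ge0 // !sqrf_eq0 => /andP[/eqP r0 /eqP i0].
  by apply/eqP; rewrite eq_complex r0 i0 eqxx.
have dN : is_derive t 1 N (2 * (Re (h t) * Re d + Im (h t) * Im d)).
  have -> : N = (fun x => Re (h x)) * (fun x => Re (h x)) +
      (fun x => Im (h x)) * (fun x => Im (h x)).
    by apply/funext => x; rewrite /N !expr2.
  apply: (is_derive_eq (is_deriveD (is_deriveM h1 h1) (is_deriveM h2 h2))).
  by rewrite /GRing.scale /=; ring.
have dNV := is_deriveV N0 dN.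
have E : - d / h t ^+ 2 = - d * ((h t)^* * (h t)^*) * ((N t)^-1%:C * (N t)^-1%:C)%C.
  have -> : ((N t)^-1)%:C%C = (h t * (h t)^*)^-1.
    by rewrite fmorphV; congr (_^-1); rewrite -normCK -add_Re2_Im2.
  have c0 : (h t)^* != 0 by rewrite conjC_eq0.
  by field; rewrite h0 c0.
split.
  have -> : (fun x => Re (h x)^-1) = (fun x => Re (h x)) * (fun x => (N x)^-1).
    apply/funext => x; change (Re (h x)^-1 = Re (h x) * (N x)^-1).
    by rewrite /N; case: (h x).
  apply: (is_derive_eq (is_deriveM h1 dNV)).
  rewrite E; move: N0; rewrite /N /GRing.scale /=.
  case: (h t) d {h0 h1 h2 dN dNV E} => [p q] [d e] /= N0.
  by field.
have -> : (fun x => Im (h x)^-1) = - (fun x => Im (h x)) * (fun x => (N x)^-1).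
  apply/funext => x; change (Im (h x)^-1 = - Im (h x) * (N x)^-1).
  by rewrite /N; case: (h x) => p q /=; rewrite mulNr.
apply: (is_derive_eq (is_deriveM (is_deriveN h2) dNV)).
change ((- (fun x => Im (h x))) t) with (- Im (h t)).
rewrite E; move: N0; rewrite /N /GRing.scale /=.
case: (h t) d {h0 h1 h2 dN dNV E} => [p q] [d e] /= N0.
by field.
Qed.

Lemma curve_derive_horner (P : {poly C}) h t d : curve_derive h t d ->
  curve_derive (fun x => P.[h x]) t (P^`().[h t] * d).
Proof.
move=> hd; elim/poly_ind: P => [|P c IH].
  have -> : (fun x => (0 : {poly C}).[h x]) = fun=> 0.
    by apply/funext => x; rewrite horner0.
  by rewrite deriv0 horner0 mul0r; apply: curve_derive_cst.
have -> : (fun x => (P * 'X + c%:P).[h x]) = fun x => P.[h x] * h x + c.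
  by apply/funext => x; rewrite hornerMXaddC.
have := curve_deriveD (curve_deriveM IH hd) (curve_derive_cst c t).
congr (curve_derive _ _ _); rewrite addr0 derivMXaddC hornerD hornerMX.
by ring.
Qed.

Lemma curve_derive_cis t : curve_derive (@cis R) t ('i%C * cis t).
Proof.
split; first by apply: (is_derive_eq (is_derive_cos t)); rewrite RecM /=; ring.
by apply: (is_derive_eq (is_derive_sin t)); rewrite ImcM /=; ring.
Qed.

Lemma continuous_Im_curve h :
  (forall t, exists d, curve_derive h t d) -> continuous (fun t => Im (h t)).
Proof.
move=> hd t; have [d [_ [dI _]]] := hd t.
exact/differentiable_continuous/derivable1_diffP.
Qed.

(** Equal values of a complex curve do not force a zero of its derivative; Rolle's theorem on the
    imaginary part yields a point where the derivative is real. *)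
Lemma curve_Rolle h h' (x y : R) : x < y ->
  (forall t, x <= t <= y -> curve_derive h t (h' t)) -> h x = h y ->
  exists2 c, x <= c <= y & Im (h' c) = 0.
Proof.
move=> xy hd hxy.
have der t : t \in `[x, y] -> derivable (fun t => Im (h t)) t 1.
  by rewrite in_itv /= => /hd [_ []].
have [|||c] := @Rolle R (fun t => Im (h t)) x y xy.
- by move=> t /subset_itv_oo_cc; apply: der.
- exact: derivable_within_continuous.
- by rewrite hxy.
rewrite in_itv /= => /andP[xc cy] [_ dc]; exists c; first by rewrite !ltW.
by have [|_ [_ <-]] := hd c; first by rewrite !ltW.
Qed.

Lemma cisD s t : cis (s + t) = cis s * cis t :> C.
Proof. by rewrite /cis cosD sinD; simpc; congr (_ +i* _)%C; ring. Qed.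

Lemma norm_cis t : `|cis t : C| = 1.
Proof. by rewrite normc_def /= cos2Dsin2 sqrtr1. Qed.

End ComplexCurves.

(** * A zero of one POPUC between two zeros of another *)

Section RolleCircle.
Variable R : realType.
Local Notation C := R[i].

(* Where Q does not vanish, h = v / (v - mu u), which has constant real part
   1/2, moves strictly along a vertical line: h' = - i (W / z^n) / |v - mu u|^2. *)
Lemma popuc_zero_between (a : nat -> C) n lam mu (x y : R) :
  let P nu := 'X * opuc a n - nu^* *: revp n (opuc a n) in
  (forall j, (j < n)%N -> `|a j| < 1) -> `|mu| = 1 -> x < y ->
  root (P lam) (cis x) -> root (P lam) (cis y) ->
  exists2 c, x <= c <= y & root (P mu) (cis c).
Proof.
move=> P an mu1 xy Px Py; apply: contrapT => noQ.
set u := 'X * opuc a n; set v := revp n (opuc a n).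
have mumu : mu * mu^* = 1 by rewrite -normCK mu1 expr1n.
pose D := v - mu *: u.
have PD : P mu = - mu^* *: D.
  by rewrite /D scalerBr scalerA mulNr [mu^* * mu]mulrC mumu scaleN1r opprK
     scaleNr addrC.
have D0 t : x <= t <= y -> D.[cis t] != 0.
  move=> xty; apply: contra_notN noQ => /eqP Dt; exists t => //.
  by rewrite PD rootE hornerZ Dt mulr0.
have v0 t : v.[cis t] != 0 by case: (@opuc_disk R a n (cis t) an); rewrite ?norm_cis.
pose h t := v.[cis t] / D.[cis t].
(* At every zero of [P lam], u = lam^* v, so [h] takes one and the same value there, as Rolle's
   theorem requires. *)
have hroot t : root (P lam) (cis t) -> h t = (1 - mu * lam^*)^-1.
  rewrite /h /D rootE !(hornerD, hornerN, hornerZ) -/u -/v subr_eq0 => /eqP ->.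
  have := v0 t; move: v.[_] => w w0.
  by rewrite mulrA -{2}[w]mul1r -mulrBl invfM mulrCA mulfV ?mulr1.
pose h' t := - 'i%C * ((u^`() * v - u * v^`()).[cis t] / cis t ^+ n / `|D.[cis t]| ^+ 2).
have [t xty||c xcy] := @curve_Rolle R h h' x y xy.
- have z1 := norm_cis t; set z := cis t in z1 *.
  have z0 : z != 0 by rewrite -normr_eq0 z1 oner_eq0.
  have zz : z * z^* = 1 by rewrite -normCK z1 expr1n.
  (* [D] is self-inversive: on the circle z^(n+1) times its conjugate is - mu^* D. This turns the
     D^2 of the quotient rule into |D|^2. *)
  have DD : `|D.[z]| ^+ 2 = - mu^* * D.[z] ^+ 2 / z ^+ n.+1.
    have Ev : v.[z] = z ^+ n * (opuc a n).[z]^*.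
      by rewrite horner_revp_circle ?size_opuc.
    have Eu : u.[z] = z * (opuc a n).[z] by rewrite hornerM hornerX.
    apply: (mulIf (expf_neq0 n.+1 z0)); rewrite divfK ?expf_neq0 //.
    rewrite normCK expr2 mulrA [- _ * _]mulrC -!mulrA; congr (_ * _).
    rewrite /D hornerD hornerN hornerZ Ev Eu.
    rewrite rmorphB !rmorphM rmorphXn /= conjCK exprSr.
    transitivity ((z * z^*) ^+ n * z * (opuc a n).[z] -
        mu^* * (z * z^*) * z ^+ n * (opuc a n).[z]^*).
      by rewrite exprMn_comm; [ring | exact: mulrC].
    rewrite zz expr1n mulr1 mul1r.
    transitivity (mu * mu^* * z * (opuc a n).[z] -
        mu^* * z ^+ n * (opuc a n).[z]^*); last by ring.
    by rewrite mumu mul1r.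
  have dc := curve_derive_cis t.
  have := curve_deriveM (curve_derive_horner v dc)
    (curve_deriveV (D0 _ xty) (curve_derive_horner D dc)).
  congr (curve_derive _ _ _).
  rewrite -/z /h' -/z DD; have := D0 _ xty; rewrite -/z => Dz.
  have mu0 : mu != 0 by rewrite -normr_eq0 mu1 oner_eq0.
  have -> : mu^* = mu^-1 by apply: (mulfI mu0); rewrite mumu mulfV.
  have z0n := expf_neq0 n z0.
  move: Dz; rewrite /D (exprS z n) derivB derivZ !(hornerD, hornerN, hornerZ).
  rewrite [(u^`() * v).[_]]hornerM [(u * _).[_]]hornerM.
  move: (u.[z]) (v.[z]) (u^`().[z]) (v^`().[z]) (z ^+ n) z0n => p q p' q' zn zn0 Dz.
  by field; rewrite mu0 zn0 z0 Dz.
- by rewrite !hroot.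
have : 0 < (u^`() * v - u * v^`()).[cis c] / cis c ^+ n / `|D.[cis c]| ^+ 2.
  by rewrite divr_gt0 ?exprn_gt0 ?normr_gt0 ?D0 // wronskian_gt0 ?norm_cis.
rewrite /h'; case: (_ / _ ^+ 2) => [p q]; rewrite ltcE /= => /andP[_ p0].
by simpc => /eqP; rewrite oppr_eq0 gt_eqF.
Qed.

End RolleCircle.

(** * Angles and arcs on the circle *)

Section CircleArcs.
Variable R : realType.
Local Notation C := R[i].

(** Angles lie in (0, 2 pi] rather than [0, 2 pi), so that the trivial rotation is a full turn, as
    in [open_arc a a]. *)
Lemma unit_circle_cis (z : C) : `|z| = 1 -> exists2 s : R, 0 < s <= 2 * pi & z = cis s.
Proof.
case: z => x y /eqP.
rewrite -(@eqrXn2 _ 2) ?normr_ge0 // ?ler01 // -add_Re2_Im2 expr1n /= => /eqP[xy].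
have x1 : -1 <= x <= 1.
  rewrite -ler_norml -(@expr_le1 _ 2) // real_normK ?num_real // -xy.
  by rewrite lerDl sqr_ge0.
have sy : sin (acos x) = `|y|.
  by rewrite sin_acos // -xy addrAC subrr add0r sqrtr_sqr.
have [acos0 acospi] := (acos_ge0 x1, acos_lepi x1).
have pi0 := pi_gt0 R.
have [y0|y0] := ltrP 0 y.
  exists (acos x); last by rewrite /cis acosK // sy gtr0_norm.
  rewrite lt_neqAle acos0 andbT; apply/andP; split; last by lra.
  by apply: contraTneq (y0) => a0; rewrite -(gtr0_norm y0) -sy -a0 sin0 ltxx.
exists (2 * pi - acos x); first by apply/andP; split; lra.
rewrite /cis mulr_natl addrC cosD2pi sinD2pi cosN sinN acosK // sy.
by rewrite ler0_norm // opprK.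
Qed.

Lemma open_arc_cis (a : C) (s t : R) : 0 < t -> t < s -> s <= 2 * pi ->
  open_arc a (a * cis s) (a * cis t).
Proof. by move=> t0 ts s2; exists s, t. Qed.

End CircleArcs.

(** * Interlacing of the zeros of two POPUCs *)

Section Direct.
Variable R : realType.
Local Notation C := R[i].

Lemma popuc_interlace (n : nat) (alpha : n.-tuple C) (lam mu : C) :
  (forall j : 'I_n, in_disk (tnth alpha j)) ->
  unit_circle lam -> unit_circle mu -> lam <> mu ->
  interlace n.+1 (zeros (popuc alpha lam)) (zeros (popuc alpha mu)).
Proof.
rewrite /unit_circle /= => adisk lam1 mu1 lamu.
pose a := nth 0 alpha.
have an j : (j < n)%N -> `|a j| < 1.
  by move=> jn; have := adisk (Ordinal jn); rewrite /in_disk (tnth_nth 0).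
have card nu : `|nu| = 1 -> (zeros (popuc alpha nu) #= `I_n.+1)%card.
  move=> nu1; apply/card_eq_uniq_seqP.
  have [s [us ss Es _]] := popuc_zeros an nu1; exists s; split=> //.
  by rewrite /zeros /popuc -/a Es; apply/seteqP; split=> z /=;
     rewrite root_prod_XsubC.
have disj z : root (popuc alpha lam) z -> root (popuc alpha mu) z -> False.
  move=> rl; have z1 := popuc_root_circle an lam1 rl.
  have [|v0 _] := opuc_disk (z := z) an; first by rewrite z1.
  move: rl; rewrite !rootE /popuc -/a !(hornerD, hornerN, hornerZ).
  rewrite !subr_eq0 => /eqP-> /eqP /(mulIf v0) /(can_inj (@conjCK _)).
  exact: lamu.
split.
- split=> z; exact: popuc_root_circle.
- by split; apply: card.
- by rewrite -subset0 => z [/=]; apply: disj.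
move=> A [x [b [/= Px Pb -> PA]]].
have x1 := popuc_root_circle an lam1 Px.
have b1 := popuc_root_circle an lam1 Pb.
have [th _ Ex] := unit_circle_cis x1.
(* [s] is the angle from [x] to [b]; for b = x it is 2 pi. *)
have [s /andP[s0 s2] Es] : exists2 s : R, 0 < s <= 2 * pi & b / x = cis s.
  by apply: unit_circle_cis; rewrite normrM normfV b1 x1 divr1.
have Eb : b = x * cis s.
  by rewrite -Es mulrC divfK // -normr_eq0 x1 oner_eq0.
have Px' : root (popuc alpha lam) (cis th) by rewrite -Ex.
have Pb' : root (popuc alpha lam) (cis (th + s)) by rewrite cisD -Ex -Eb.
(* Existence: Rolle gives a zero in the closed arc, and disjointness then excludes the endpoints. *)
have [|c /andP[c1 c2] Qc] := popuc_zero_between an mu1 _ Px' Pb'.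
  by rewrite ltrDl.
have {}c1 : th < c.
  by rewrite lt_neqAle c1 andbT; apply: contra_notN (disj (cis th) Px') => /eqP ->.
have {}c2 : c < th + s.
  by rewrite lt_neqAle c2 andbT; apply: contra_notN (disj _ Pb') => /eqP <-.
exists (cis c); split.
  split=> //; have -> : cis c = x * cis (c - th).
    by rewrite Ex -cisD addrC subrK.
  by rewrite Eb; apply: open_arc_cis => //; [rewrite subr_gt0|rewrite ltrBlDl].
(* Uniqueness: with [lam] and [mu] exchanged, two zeros in the arc would enclose a zero of the first
   polynomial. [s'] stays general because each membership in [open_arc] carries its own end
   angle. *)
have uniq_w t1 t2 s' : 0 < t1 -> t1 < t2 -> t2 < s' -> s' <= 2 * pi ->
    b = x * cis s' -> root (popuc alpha mu) (x * cis t1) ->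
    root (popuc alpha mu) (x * cis t2) -> False.
  move=> t1_0 t12 t2s s2' Eb'; rewrite Ex -!cisD => Q1 Q2.
  have [|d /andP[d1 d2] Pd] := popuc_zero_between an lam1 _ Q1 Q2.
    by rewrite ltrD2l.
  have : (open_arc x b `&` zeros (popuc alpha lam)) (cis d); last by rewrite PA.
  split=> //; have -> : cis d = x * cis (d - th).
    by rewrite Ex -cisD addrC subrK.
  by rewrite Eb'; apply: open_arc_cis => //; lra.
move=> w [[s' [t [t0 ts s'2 Eb' ->]]] /= Qw].
have {}Qc : root (popuc alpha mu) (x * cis (c - th)).
  by rewrite Ex -cisD addrC subrK.
have -> : cis c = x * cis (c - th) by rewrite Ex -cisD addrC subrK.
have [tc|ct|-> //] := ltgtP (c - th) t.
- by case: (uniq_w (c - th) t s') => //; rewrite subr_gt0.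
- by case: (uniq_w t (c - th) s) => //; rewrite ltrBlDl.
Qed.

End Direct.

(** * Recovery of the Verblunsky coefficients (Schur-Cohn) *)

Section SchurCohn.
Variable R : realType.
Local Notation C := R[i].
Implicit Types (P : {poly C}) (z : C).

(** Blaschke factors: |1 - x^* z| <= |z - x| for |x| < 1 <= |z|, which is [ler_norm_szego] with u =
    1 and v = z. *)
Lemma norm_revp_prod_le (s : seq C) z :
  {in s, forall x, `|x| < 1} -> 1 <= `|z| ->
  `|(revp (size s) (\prod_(x <- s) ('X - x%:P))).[z]| <=
  `|(\prod_(x <- s) ('X - x%:P)).[z]|.
Proof.
move=> + z1; elim: s => [|x s IH] sd.
  by rewrite big_nil revp01.
rewrite big_cons revp_mulXsubC ?size_prod_XsubC // !hornerM !normrM.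
apply: ler_pM => //; last by apply: IH => y ys; apply: sd; rewrite inE ys orbT.
have := @ler_norm_szego R x 1 z; rewrite mulr1 => H.
rewrite !(hornerD, hornerN, hornerZ, hornerX, hornerC) H ?normr1 //.
by apply: sd; rewrite mem_head.
Qed.

Lemma opuc_surj n P : P \is monic -> size P = n.+1 ->
  (forall z, root P z -> `|z| < 1) ->
  exists2 a : nat -> C, (forall j, (j < n)%N -> `|a j| < 1) & opuc a n = P.
Proof.
elim: n P => [|n IH] P mP sP rP.
  exists (fun=> 0) => //=; have /size_poly1P[c _ Pc] : size P == 1%N by rewrite sP.
  by move: mP; rewrite Pc monicE lead_coefC => /eqP ->.
(* By [opucS0] this is the only possible last coefficient; its modulus is the product of the moduli
   of the zeros, hence below 1. *)
pose al := - (P.[0])^*; pose c := 1 - al * al^*.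
have [s Es] := closed_field_poly_normal P.
rewrite (monicP mP) scale1r in Es.
have ss : size s = n.+1 by apply: succn_inj; rewrite -sP Es size_prod_XsubC.
have sd : {in s, forall x, `|x| < 1}.
  by move=> x xs; apply: rP; rewrite Es root_prod_XsubC.
have al1 : `|al| < 1.
  rewrite /al normrN norm_conjC Es horner_prod normr_prod.
  case: s {Es} ss sd => // x s _ sd; rewrite big_cons hornerXsubC sub0r normrN.
  have x1 : `|x| < 1 by apply: sd; rewrite mem_head.
  apply: le_lt_trans x1; rewrite ler_piMr ?normr_ge0 //.
  rewrite big_seq prodr_ile1 // => y ys; rewrite normr_ge0 /=.
  by rewrite hornerXsubC sub0r normrN ltW // sd // inE ys orbT.
have cr : c^* = c by rewrite /c rmorphB rmorphM rmorph1 /= conjCK mulrC.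
have c0 : c != 0 by rewrite /c -normCK subr_eq0 gt_eqF // exprn_ilt1.
(* Solving the Szego recursion and its companion for z Phi_n gives P + al^* P^* = c z Phi_n. So z
   has to divide [S], and [Psi] below is the candidate for Phi_n. *)
pose S := P + al^* *: revp n.+1 P.
have sS : (size S <= n.+2)%N.
  rewrite (leq_trans (size_polyD _ _)) // geq_max sP leqnn.
  by rewrite (leq_trans (size_scale_leq _ _)) ?size_revp.
have Pn : P`_n.+1 = 1 by have /monicP := mP; rewrite lead_coefE sP.
have S0 : S`_0 = 0.
  by rewrite coefD coefZ coef_revp subn0 Pn rmorph1 mulr1 /al rmorphN /= conjCK
     horner_coef0 subrr.
have Sn : S`_n.+1 = c.
  rewrite coefD coefZ coef_revp leqnn subnn Pn /c /al horner_coef0.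
  by rewrite !rmorphN /= conjCK mulrNN mulNr mulrC.
have revS : revp n.+1 S = revp n.+1 P + al *: P.
  by rewrite revpD revpZ conjCK revpK ?sP.
pose Psi := c^-1 *: drop_poly 1 S.
have XPsi : 'X * Psi = c^-1 *: S.
  apply/polyP => -[|i]; rewrite coefXM !coefZ ?S0 ?mulr0 //=.
  by rewrite coef_drop_poly addn1.
have Psin : Psi`_n = 1 by rewrite coefZ coef_drop_poly addn1 Sn mulVf.
have sPsi : size Psi = n.+1.
  apply/eqP; rewrite eqn_leq; apply/andP; split.
    rewrite (leq_trans (size_scale_leq _ _)) // size_drop_poly.
    by rewrite leq_subLR add1n.
  by rewrite ltnNge; apply: contra_eqN Psin => /leq_sizeP -> //; rewrite eq_sym oner_eq0.
have mPsi : Psi \is monic by rewrite monicE lead_coefE sPsi /= Psin.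
have revPsi : revp n Psi = c^-1 *: (revp n.+1 P + al *: P).
  by rewrite -revpXM XPsi revpZ revS fmorphV /= cr.
(* A zero of [Psi] with |z| >= 1 would give |P| = |al| |P^*| <= |al| |P| < |P| there, P(z) being
   nonzero. *)
have [z|a an Ea] := IH Psi mPsi sPsi.
  rewrite -(rootZ _ _ c0) /Psi => rz.
  have Sz : S.[z] = 0.
    move: rz; rewrite !rootE !hornerZ mulrA mulfV // mul1r => /eqP dz.
    have -> : S = c *: ('X * Psi) by rewrite XPsi scalerA mulfV // scale1r.
    by rewrite hornerZ hornerM /Psi hornerZ dz !mulr0.
  rewrite real_ltNge ?normr_real ?real1 //; apply/negP => z1.
  have Pz : 0 < `|P.[z]|.
    rewrite normr_gt0; apply/negP => /rP; rewrite real_ltNge ?normr_real ?real1 //.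
    by rewrite z1.
  have := norm_revp_prod_le sd z1; rewrite ss -Es => h.
  move/eqP: Sz; rewrite /S hornerD hornerZ addr_eq0 => /eqP /(congr1 Num.norm).
  rewrite normrN normrM norm_conjC => E.
  have : `|P.[z]| < `|P.[z]|; last by rewrite ltxx.
  by rewrite {1}E (le_lt_trans (ler_wpM2l (normr_ge0 _) h)) // gtr_pMl.
exists (fun j => if j == n then al else a j) => [j|].
  by rewrite ltnS leq_eqVlt; case: eqP => // _ /an.
rewrite opucS eqxx; have -> : opuc (fun j => if j == n then al else a j) n = Psi.
  by rewrite -Ea; apply: eq_opuc => j jn; rewrite ltn_eqF.
rewrite XPsi revPsi scalerA mulrC -scalerA -scalerBr.
rewrite -[RHS]scale1r -(mulVf c0) -scalerA; congr (_ *: _).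
rewrite /S scalerDr scalerA opprD addrA addrK.
by rewrite /c scalerBl scale1r mulrC.
Qed.

(** The last coefficient is read off at 0; then [key] recovers Phi_n from Phi_{n+1}, the factor 1 -
    |a_n|^2 being nonzero. *)
Lemma opuc_inj (a b : nat -> C) n :
  (forall j, (j < n)%N -> `|a j| < 1) -> (forall j, (j < n)%N -> `|b j| < 1) ->
  opuc a n = opuc b n -> forall j, (j < n)%N -> a j = b j.
Proof.
elim: n => // n IH an bn E.
have En : a n = b n.
  apply: (can_inj (@conjCK _)); apply: oppr_inj.
  by rewrite -!opucS0 E.
have key (c : nat -> C) : opuc c n.+1 + (c n)^* *: revp n.+1 (opuc c n.+1) =
    (1 - c n * (c n)^*) *: ('X * opuc c n).
  rewrite revp_opucS opucS scalerBr scalerA addrA subrK.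
  by rewrite scalerBl scale1r [c n * _]mulrC.
have c0 : 1 - b n * (b n)^* != 0.
  by rewrite -normCK subr_eq0 gt_eqF // exprn_ilt1 // bn.
have {}E : opuc a n = opuc b n.
  apply: (mulfI (negbT (polyX_eq0 _))); apply: (scalerI c0).
  by rewrite -key -E -En key.
move=> j; rewrite ltnS leq_eqVlt => /orP[/eqP->//|jn].
by apply: IH => // k kn; [apply: an|apply: bn]; exact: ltnW.
Qed.

End SchurCohn.

(** * Half-angle factorisation and neighbouring points on the circle *)

Section Angles.
Variable R : realType.
Local Notation C := R[i].
Implicit Types (s t x : R) (z : C) (ts : seq R).

Lemma cis_neq0 t : cis t != 0 :> C.
Proof. by rewrite -normr_eq0 norm_cis oner_eq0. Qed.

Lemma cis_inj s t : 0 < s <= 2 * pi -> 0 < t <= 2 * pi ->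
  cis s = cis t :> C -> s = t.
Proof.
wlog st : s t / s <= t => [hw hs ht E|].
  by case: (leP s t) => [|/ltW] h; [|apply/esym]; apply: hw.
move=> /andP[s0 s2] /andP[t0 t2] [E1 E2]; apply/eqP; rewrite eq_le st leNgt /=.
apply/negP => {}st; have pos : 0 < sin ((t - s) / 2).
  by apply: sin_gt0_pi; apply/andP; split; lra.
have : cos (t - s) = 1 by rewrite cosB E1 E2 -!expr2 cos2Dsin2.
have {1}-> : t - s = ((t - s) / 2) *+ 2 by rewrite -mulr_natr divfK.
rewrite cos_mulr2n cos2sin2 => h; have := exprn_gt0 2 pos; lra.
Qed.

Lemma cisN t : cis (- t) = (cis t)^-1 :> C.
Proof.
apply: (mulfI (cis_neq0 t)); rewrite mulfV ?cis_neq0 // -cisD subrr.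
by rewrite /cis cos0 sin0.
Qed.

Lemma sin_cis t : (2 * 'i%C) * (sin t)%:C%C = cis t - cis (- t) :> C.
Proof.
rewrite [cis t]complexE [cis (- t)]complexE /= cosN sinN rmorphN /=; ring.
Qed.

Lemma cis_sub t x : cis t - cis x =
  (2 * 'i%C * cis (x / 2)) * cis (t / 2) * (sin ((t - x) / 2))%:C%C :> C.
Proof.
transitivity (2 * 'i%C * (sin ((t - x) / 2))%:C%C * cis (x / 2) * cis (t / 2) : C);
  last by ring.
have -> : (t - x) / 2 = t / 2 + - (x / 2) by field.
rewrite sin_cis opprD opprK !cisD !cisN.
have {1}-> : t = t / 2 + t / 2 by field.
have {1}-> : x = x / 2 + x / 2 by field.
by rewrite !cisD; field; rewrite !cis_neq0.
Qed.

(** [sin_prod] and [cis_cst] are the real function and the constant split off in [horner_prod_cis].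
    They depend on the angles, not only on the points: adding 2 pi to one angle flips the sign of
    both. *)
Definition sin_prod ts t : R := \prod_(x <- ts) sin ((t - x) / 2).

Definition cis_cst ts : C := \prod_(x <- ts) (2 * 'i%C * cis (x / 2)).

Lemma horner_prod_cis ts t :
  (\prod_(z <- map (@cis R) ts) ('X - z%:P)).[cis t] =
  cis_cst ts * cis (t / 2) ^+ size ts * (sin_prod ts t)%:C%C.
Proof.
rewrite /cis_cst /sin_prod; elim: ts => [|x ts IH].
  by rewrite /= !big_nil hornerC expr0 rmorph1 !mulr1.
rewrite /= !big_cons hornerM IH hornerXsubC cis_sub exprS rmorphM /=; ring.
Qed.

(** Each factor squares to - 4 cis x, four times the value at 0 of its linear factor. Hence P(0) /
    kP = kP / 4^N. *)
Lemma cis_cst_sqr ts : cis_cst ts ^+ 2 =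
  4 ^+ size ts * (\prod_(z <- map (@cis R) ts) ('X - z%:P)).[0].
Proof.
rewrite /cis_cst; elim: ts => [|x ts IH].
  by rewrite /= !big_nil hornerC expr0 expr1n mulr1.
rewrite /= !big_cons exprMn IH hornerM hornerXsubC (exprS 4) sub0r.
have -> : (2 * 'i%C * cis (x / 2)) ^+ 2 = - (4 * cis x) :> C.
  have {2}-> : x = x / 2 + x / 2 by field.
  by rewrite cisD exprMn exprMn sqr_i -natrX; ring.
by ring.
Qed.

Lemma cis_cst_norm ts : `|cis_cst ts| = 2 ^+ size ts.
Proof.
rewrite /cis_cst; elim: ts => [|x ts IH]; first by rewrite big_nil normr1.
rewrite big_cons normrM IH exprS; congr (_ * _).
rewrite !normrM norm_cis mulr1 normr_nat.
have -> : `|'i%C : C| = 1 by rewrite normc_def /= expr0n add0r expr1n sqrtr1.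
by rewrite mulr1.
Qed.

Lemma cis_cst_neq0 ts : cis_cst ts != 0.
Proof. by rewrite -normr_eq0 cis_cst_norm expf_neq0 // pnatr_eq0. Qed.

Lemma continuous_sin_prod ts : continuous (sin_prod ts).
Proof.
rewrite /sin_prod; elim: ts => [|x ts IH] t.
  under eq_fun do rewrite big_nil.
  exact: cvg_cst.
under eq_fun do rewrite big_cons.
apply: cvgM; last exact: IH.
apply: (@continuous_comp _ _ _ (fun t => (t - x) / 2) (@sin R)); last exact: continuous_sin.
apply: cvgM; last exact: cvg_cst.
apply: cvgB; [exact: cvg_id|exact: cvg_cst].
Qed.

Lemma seq_cis (s : seq C) : {in s, forall z, `|z| = 1} ->
  exists ts : seq R, s = map (@cis R) ts.
Proof.
elim: s => [|z s IH] hs; first by exists [::].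
have [ts ->] : exists ts : seq R, s = map (@cis R) ts.
  by apply: IH => y ys; apply: hs; rewrite inE ys orbT.
have [|t _ ->] := @unit_circle_cis R z; first by apply: hs; rewrite mem_head.
by exists (t :: ts).
Qed.

(* 2 sin A sin B = cos (A - B) - cos (A + B), so that only cis x matters. *)
Lemma sin_mul_shift (th s t x : R) : cis x = cis th * cis t :> C ->
  sin ((th - x) / 2) * sin ((th + s - x) / 2) = - (sin (t / 2) * sin ((s - t) / 2)).
Proof.
rewrite -cisD => -[Ec Es].
have prod2 (p q : R) : sin p * sin q = (cos (p - q) - cos (p + q)) / 2.
  by rewrite cosB cosD; field.
rewrite !prod2.
have -> : (th - x) / 2 - (th + s - x) / 2 = - (s / 2) by field.
have -> : (th - x) / 2 + (th + s - x) / 2 = th - x + s / 2 by field.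
have -> : t / 2 + (s - t) / 2 = s / 2 by field.
have -> : t / 2 - (s - t) / 2 = t - s / 2 by field.
rewrite cosN -mulNr opprB; congr ((_ - _) / 2).
rewrite [LHS]cosD [RHS]cosB cosB sinB Ec Es cosD sinD.
by have := cos2Dsin2 th; rewrite !expr2; move=> h; rewrite -[RHS]mul1r -h; ring.
Qed.

Lemma seq_min (s : seq R) : s != [::] ->
  exists2 m, m \in s & {in s, forall x, m <= x}.
Proof.
elim: s => // x s IH _; have [->|/IH[m ms hm]] := eqVneq s [::].
  by exists x; rewrite ?mem_head // => y; rewrite inE => /eqP->.
have [xm|mx] := leP x m.
  exists x; first exact: mem_head.
  by move=> y; rewrite inE => /orP[/eqP->//|/hm]; apply: le_trans.
exists m; first by rewrite inE ms orbT.
by move=> y; rewrite inE => /orP[/eqP->|/hm//]; exact: ltW.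
Qed.

(** Take the least angle from [z] to a point of [s]. Here [z] itself counts with angle 2 pi, so a
    one-point list gives a full turn. *)
Lemma next_on_circle (s : seq C) (z : C) :
  {in s, forall z, `|z| = 1} -> z \in s ->
  exists l : R, [/\ 0 < l <= 2 * pi, z * cis l \in s &
    forall t, 0 < t < l -> z * cis t \notin s].
Proof.
move=> hs zs; have z0 : z != 0 by rewrite -normr_eq0 hs // oner_eq0.
have /choice[ang angP] : forall y : C, exists t : R,
    `|y| = 1 -> 0 < t <= 2 * pi /\ y = cis t.
  move=> y; have [/eqP/unit_circle_cis[t]|/eqP] := boolP (`|y| == 1).
    by exists t.
  by exists 0.
have ys y : y \in s -> `|y / z| = 1.
  by move=> ?; rewrite normrM normfV !hs // divr1.
have [|l /mapP[y ysy El] hl] := @seq_min [seq ang (y / z) | y <- s].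
  by case: (s) zs.
have [l2 Ey] := angP _ (ys _ ysy); exists l; split; first by rewrite El.
  by rewrite El -Ey mulrC divfK.
move=> t /andP[t0 tl]; apply/negP => zt.
have [t2 Et] := angP _ (ys _ zt).
have := hl _ (map_f (fun y => ang (y / z)) zt).
have -> : ang (z * cis t / z) = t.
  apply: cis_inj => //; last by rewrite -Et mulrAC mulfV // mul1r.
  by rewrite t0 (le_trans (ltW tl)) // El; case/andP: l2.
by rewrite leNgt tl.
Qed.

Lemma IVT_sign (f : R -> R) (a b : R) : a <= b -> continuous f ->
  f a * f b < 0 -> exists2 c, a < c < b & f c = 0.
Proof.
move=> ab cf fab.
have [||c] := @IVT R f a b 0 ab.
- by apply: continuous_subspaceT.
- rewrite minEle maxEle; move: fab; have [fa|fa] := leP (f a) (f b); rewrite ?fa => h.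
    by apply/andP; split; nra.
  by apply/andP; split; nra.
rewrite in_itv /= => /andP[ac cb] fc; exists c => //.
rewrite !lt_neqAle ac cb !andbT; apply/andP; split; apply: contraTneq fab => E.
  by rewrite E fc mul0r ltxx.
by rewrite -E fc mulr0 ltxx.
Qed.

End Angles.

(** * Real pencils of the two normalised products *)

Section Pencil.
Variable R : realType.
Local Notation C := R[i].
Variables (tz tw : seq R).
Hypothesis zw : interlace (size tz) [set` map (@cis R) tz] [set` map (@cis R) tw].
Hypotheses (uz : uniq (map (@cis R) tz)) (uw : uniq (map (@cis R) tw)).
Hypothesis tz0 : tz != [::].
Hypothesis szw : size tw = size tz.

Local Notation P := (\prod_(z <- map (@cis R) tz) ('X - z%:P)).
Local Notation Q := (\prod_(z <- map (@cis R) tw) ('X - z%:P)).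
Local Notation kz := (cis_cst tz).
Local Notation kw := (cis_cst tw).

Lemma disjoint_zeros z : root P z -> root Q z -> False.
Proof.
rewrite !root_prod_XsubC => Pz Qz; case: zw => _ _ zw0 _.
by have : ([set` map (@cis R) tz] `&` [set` map (@cis R) tw]) z;
  [split | rewrite zw0].
Qed.

Lemma norm_cis_seq (ts : seq R) (z : C) : z \in map (@cis R) ts -> `|z| = 1.
Proof. by case/mapP => t _ ->; rewrite norm_cis. Qed.

(** By [sin_mul_shift] a point at angle t past [cis th] contributes - sin (t / 2) sin ((l - t) / 2):
    negative for the single point inside the arc, where 0 < t < l, and positive for the others,
    where l < t < 2 pi. *)
Lemma sin_prod_sign_change (th l : R) : 0 < l <= 2 * pi ->
  cis th \in map (@cis R) tz -> cis (th + l) \in map (@cis R) tz ->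
  (forall t, 0 < t < l -> cis th * cis t \notin map (@cis R) tz) ->
  sin_prod tw th * sin_prod tw (th + l) < 0.
Proof.
move=> /andP[l0 l2] z1 z2 free.
(* [open_arc] hides its end angle; injectivity of [cis] identifies it with [l]. *)
have len_uniq l' : 0 < l' -> l' <= 2 * pi -> cis (th + l) = cis th * cis l' ->
    l' = l.
  move=> l'0 l'2 El; apply: (@cis_inj R); rewrite ?l0 ?l2 ?l'0 ?l'2 //.
  by apply: (mulfI (cis_neq0 th)); rewrite -El cisD.
case: zw => _ _ _ /(_ (open_arc (cis th) (cis (th + l)))) [].
  exists (cis th), (cis (th + l)); split=> //.
  rewrite -subset0 => _ [[l' [t [t0 tl l'2 El ->]]] /=].
  apply/negP; apply: free; rewrite t0 (lt_le_trans tl) //.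
  by rewrite (len_uniq l') // (lt_trans t0).
move=> w0 [[[l' [t [t0 tl l'2 El Ew0]]] /= w0W] w0_uniq].
have {}El : l' = l by rewrite (len_uniq l') // (lt_trans t0).
case/mapP: w0W => x0 x0w E0; rewrite /sin_prod -big_split /=.
rewrite (perm_big _ (perm_to_rem x0w)) /= big_cons.
rewrite (@sin_mul_shift R th l t) -?E0 // mulNr oppr_lt0 mulr_gt0 //.
  rewrite El in tl; rewrite mulr_gt0 // sin_gt0_pi //; apply/andP; split; lra.
rewrite big_seq prodr_gt0 // => x xr.
have xw0 : cis x != w0.
  have : uniq (map (@cis R) (x0 :: rem x0 tw)).
    by rewrite -(perm_uniq (perm_map _ (perm_to_rem x0w))).
  rewrite /= -E0 => /andP[+ _]; apply: contraNneq => <-.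
  exact: map_f.
have xw : cis x \in map (@cis R) tw by apply/map_f/(mem_rem xr).
have Qx : root Q (cis x) by rewrite root_prod_XsubC.
have [|t' /andP[t'0 t'2] Et'] := @unit_circle_cis R (cis x / cis th).
  by rewrite normrM normfV !norm_cis divr1.
have {}Et' : cis x = cis th * cis t' by rewrite -Et' mulrC divfK // cis_neq0.
have nP : ~ root P (cis x) by move=> /disjoint_zeros /(_ Qx).
have t'2' : t' < 2 * pi.
  rewrite lt_neqAle t'2 andbT; apply: contra_notN nP => /eqP t'E.
  rewrite Et' t'E /cis mulr_natl cos2pi sin2pi.
  by rewrite (_ : (1 +i* 0)%C = 1 :> C) // mulr1 root_prod_XsubC.
have lt' : l < t'.
  rewrite ltNge; apply/negP; rewrite le_eqVlt => /orP[/eqP t'E|t'l].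
    by apply: nP; rewrite Et' t'E -cisD root_prod_XsubC.
  move/eqP: xw0; apply; apply/esym/w0_uniq; split=> //.
  by rewrite Et' cisD; apply: open_arc_cis.
rewrite (sin_mul_shift l Et') -mulrN -sinN mulr_gt0 // sin_gt0_pi //.
  by apply/andP; split; lra.
by apply/andP; split; lra.
Qed.

(** With [r] real, the pencil is on the circle a nonvanishing factor times a real function. *)
Definition pencil (r : R) : {poly C} := kz^-1 *: P - (r%:C%C / kw) *: Q.

Lemma horner_pencil_cis (r t : R) : (pencil r).[cis t] =
  cis (t / 2) ^+ size tz * (sin_prod tz t - r * sin_prod tw t)%:C%C.
Proof.
rewrite /pencil hornerD hornerN !hornerZ !horner_prod_cis szw.
rewrite rmorphB rmorphM /=; field.
by rewrite !cis_cst_neq0.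
Qed.

Lemma sin_prod_eq0 (ts : seq R) t : cis t \in map (@cis R) ts -> sin_prod ts t = 0.
Proof.
rewrite -root_prod_XsubC rootE horner_prod_cis !mulf_eq0 expf_eq0.
by rewrite (negPf (cis_cst_neq0 _)) (negPf (cis_neq0 _)) andbF => /eqP[].
Qed.

Lemma size_pencil r : (size (pencil r) <= (size tz).+1)%N.
Proof.
rewrite (leq_trans (size_polyD _ _)) // geq_max size_polyN.
by rewrite !(leq_trans (size_scale_leq _ _)) // size_prod_XsubC size_map ?szw.
Qed.

(** At both ends of an arc between neighbouring zeros of P the real function is - r [sin_prod tw],
    which changes sign; the intermediate value theorem gives a root in each arc. *)
Lemma pencil_roots (r : R) : r != 0 ->
  exists s : seq C, [/\ uniq s, size s = size tz, {in s, forall z, `|z| = 1}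
    & all (root (pencil r)) s].
Proof.
move=> r0; have zs1 : {in map (@cis R) tz, forall z, `|z| = 1}.
  by move=> z; apply: norm_cis_seq.
have /choice[f fP] : forall z : C, exists y : C, z \in map (@cis R) tz ->
    root (pencil r) y /\ exists t l : R, [/\ 0 < t, t < l, y = z * cis t &
      forall t', 0 < t' < l -> z * cis t' \notin map (@cis R) tz].
  move=> z; have [zs|] := boolP (z \in map (@cis R) tz); last by exists 0.
  have [l [l02 zl free]] := next_on_circle zs1 zs.
  case/mapP: (zs) => th _ Ez; rewrite Ez in zs zl free.
  rewrite -cisD in zl; have := sin_prod_sign_change l02 zs zl free => sgn.
  have [|||c /andP[c1 c2] fc] := @IVT_sign R
      (fun t => sin_prod tz t - r * sin_prod tw t) th (th + l).
  - by rewrite lerDl; case/andP: l02 => /ltW.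
  - move=> t; apply: cvgB; first exact: continuous_sin_prod.
    by apply: cvgM; [exact: cvg_cst|exact: continuous_sin_prod].
  - rewrite (sin_prod_eq0 zs) (sin_prod_eq0 zl) !sub0r mulrNN mulrACA pmulr_rlt0 //.
    by rewrite -expr2 exprn_even_gt0.
  exists (cis c) => _; split; first by rewrite rootE horner_pencil_cis fc mulr0.
  exists (c - th), l; split; rewrite ?subr_gt0 ?ltrBlDl //.
  - by rewrite Ez -cisD addrC subrK.
  - by rewrite Ez.
exists (map f (map (@cis R) tz)); split.
- rewrite map_inj_in_uniq // => z z' zs zs' E.
  have [_ [t [l [t0 tl Ey free]]]] := fP z zs.
  have [_ [t' [l' [t'0 tl' Ey' free']]]] := fP z' zs'.
  rewrite {}E {}Ey' in Ey.
  have shift (x x' : C) (s s' : R) : x * cis s = x' * cis s' -> x = x' * cis (s' - s).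
    move=> E; apply: (mulIf (cis_neq0 s)).
    by rewrite E -mulrA -cisD subrK.
  (* If two arcs shared a root, the starting point nearer to it would lie inside the other arc. *)
  have [tt'|tt'|tt'] := ltgtP t t'.
  + have := free' (t' - t); rewrite -(shift z z' t t') // zs => h.
    suff : 0 < t' - t < l' by move=> /h.
    by rewrite subr_gt0 tt' /= ltrBlDl
      (lt_trans tl') // ltrDr.
  + have := free (t - t'); rewrite -(shift z' z t' t) // zs' => h.
    suff : 0 < t - t' < l by move=> /h.
    by rewrite subr_gt0 tt' /= ltrBlDl
      (lt_trans tl) // ltrDr.
  + by apply: (mulIf (cis_neq0 t)); rewrite -Ey tt'.
- by rewrite !size_map.
- move=> y /mapP[z zs ->]; have [_ [t [l [_ _ -> _]]]] := fP z zs.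
  by rewrite normrM norm_cis mulr1 zs1.
- by apply/allP => y /mapP[z zs ->]; case: (fP z zs).
Qed.

(* Off the circle the ratio of the two normalised products is not real:
   otherwise a real pencil of degree N would have N + 1 zeros. *)
Lemma ratio_not_real (z : C) : `|z| <> 1 ->
  Im ((P.[z] / kz) * (Q.[z] / kw)^*) <> 0.
Proof.
move=> z1 imz.
have notroot (ts : seq R) : ~ root (\prod_(x <- map (@cis R) ts) ('X - x%:P)) z.
  by rewrite root_prod_XsubC => /norm_cis_seq.
set A := P.[z] / kz in imz; set B := Q.[z] / kw in imz.
have B0 : B != 0.
  rewrite /B mulf_neq0 ?invr_eq0 ?cis_cst_neq0 //.
  by apply/negP => /notroot.
have A0 : A != 0.
  rewrite /A mulf_neq0 ?invr_eq0 ?cis_cst_neq0 //.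
  by apply/negP => /notroot.
have Breal : B * B^* \is Num.real by rewrite -normCK realX // normr_real.
(* A B^* is real, hence so is its quotient A / B by |B|^2; this makes z a root of [pencil r]. *)
have [r Er] : exists r : R, A = r%:C%C * B.
  have : A / B \is Num.real.
    have -> : A / B = A * B^* / (B * B^*).
      by rewrite (invfM B B^*) mulrACA (mulfV (_ : B^* != 0)) ?conjC_eq0 // mulr1.
    rewrite rpred_div //; move: imz; case: (A * B^*) => p q /= ->.
    by rewrite complex_real.
  by move=> /complex_realP[r Er]; exists r; rewrite -Er divfK.
have r0 : r != 0 by apply: contraNneq A0 => r0; rewrite Er r0 rmorph0 mul0r.
have [s [us ss s1 sr]] := pencil_roots r0.
have pz : root (pencil r) z.
  rewrite rootE /pencil hornerD hornerN !hornerZ mulrC -/A Er mulrAC.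
  by rewrite -mulrA -/B subrr.
have pen0 : pencil r = 0.
  apply/eqP; apply: contraTT (size_pencil r) => pen0; rewrite -ltnNge.
  rewrite -ss; apply: (@max_poly_roots _ _ (z :: s)) => //=.
    by rewrite pz.
  by rewrite us andbT; apply/negP => /s1.
(* A vanishing pencil with r nonzero turns any zero of P into a zero of Q. *)
have [x xz] : exists x, x \in tz.
  by case: (tz) tz0 => // x ? _; exists x; rewrite mem_head.
have Px : root P (cis x) by rewrite root_prod_XsubC map_f.
apply: (disjoint_zeros Px).
have /eqP : (pencil r).[cis x] = 0 by rewrite pen0 horner0.
move: Px; rewrite /pencil hornerD hornerN !hornerZ !rootE => /eqP ->.
rewrite mulr0 sub0r oppr_eq0 !mulf_eq0 invr_eq0 (negPf (cis_cst_neq0 _)) orbF.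
by rewrite (_ : r%:C%C == 0 = false) // -(rmorph0 (real_complex R)) (inj_eq (@complexI R)) (negPf r0).
Qed.

Lemma ImZ (r : R) (x : C) : Im (r%:C%C * x) = r * Im x.
Proof. by rewrite ImcM /= mul0r addr0. Qed.

Lemma cis_cst_conj (ts : seq R) :
  cis_cst ts * (cis_cst ts)^* = (4 ^+ size ts)%:C%C.
Proof.
by rewrite -normCK cis_cst_norm -exprM mulnC exprM rmorphXn /= rmorph_nat -(natrX _ 2 2).
Qed.

Lemma Im_conj_swap (x y : C) : Im (x * y^*) = - Im (y * x^*).
Proof. by case: x y => [a b] [c d] /=; ring. Qed.

(** Where Q is nonzero this has the sign of the imaginary part of P kw / (Q kz); the product form
    avoids dividing by Q. *)
Let f (z : C) : R := Im ((P.[z] / kz) * (Q.[z] / kw)^*).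
Let N4 : R := 4 ^+ size tz.
Let N4_gt0 : 0 < N4. Proof. by rewrite exprn_gt0. Qed.

(** By [cis_cst_sqr] the normalised products take the values kz / 4^N and kw / 4^N at 0. *)
Lemma Im_ratio0 : f 0 = (N4^-1) ^+ 2 * Im (kz * kw^*).
Proof.
have val0 (ts : seq R) : size ts = size tz ->
    (\prod_(z <- map (@cis R) ts) ('X - z%:P)).[0] / cis_cst ts =
    (N4^-1)%:C%C * cis_cst ts.
  move=> sts; apply: (mulIf (cis_cst_neq0 ts)); rewrite divfK ?cis_cst_neq0 //.
  rewrite -mulrA -expr2 cis_cst_sqr sts fmorphV /= /N4 rmorphXn /= rmorph_nat.
  by rewrite mulKf // expf_neq0 // pnatr_eq0.
rewrite /f !val0 // rmorphM /= [((N4^-1)%:C)%C^*](conjc_real N4^-1).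
by rewrite mulrACA -rmorphM ImZ -expr2.
Qed.

(** Where P = Q the product in [f] is |Q / kw|^2 kw / kz, and kw / kz is a positive multiple of the
    conjugate of kz kw^*; hence the sign opposite to [Im_ratio0]. *)
Lemma Im_ratio_eq (z : C) : P.[z] = Q.[z] ->
  exists2 b : R, 0 <= b & f z = - b * Im (kz * kw^*).
Proof.
move=> E; rewrite /f E -[Q.[z]](divfK (cis_cst_neq0 tw)) mulfK ?cis_cst_neq0 //.
set B := Q.[z] / kw.
have [b b0 Eb] : exists2 b : R, 0 <= b & B * B^* = b%:C%C.
  exists (Re B ^+ 2 + Im B ^+ 2); first by rewrite addr_ge0 ?sqr_ge0.
  by rewrite add_Re2_Im2 normCK.
exists (b / N4); first by rewrite divr_ge0 // ltW.
have -> : B * kw / kz * B^* = (b / N4)%:C%C * (kw * kz^*).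
  rewrite (rmorphM (real_complex R)) (fmorphV (real_complex R)) /=.
  rewrite -Eb -cis_cst_conj.
  have c0 : kz^* != 0 by rewrite conjC_eq0 cis_cst_neq0.
  by field; rewrite c0 cis_cst_neq0.
by rewrite ImZ [in RHS]Im_conj_swap mulrN mulNr opprK.
Qed.

Lemma horner_neq_disk (z : C) : `|z| <= 1 -> P.[z] != Q.[z].
Proof.
have iota0 : Im (kz * kw^*) <> 0.
  move=> I0; apply: (@ratio_not_real 0); last by rewrite -/(f 0) Im_ratio0 I0 mulr0.
  by rewrite normr0 => /eqP; rewrite eq_sym oner_eq0.
rewrite le_eqVlt => /orP[/eqP z1|z1]; apply/negP => /eqP E.
  (* On the circle P = Q reads kz [sin_prod tz] = kw [sin_prod tw]. Multiplied by the conjugate of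
     kw the right side is real, so [iota0] forces [sin_prod tz] to vanish, giving a common zero. *)
  have [t _ Ez] := unit_circle_cis z1; rewrite {}Ez in E.
  move: (E); rewrite !horner_prod_cis szw -!mulrA.
  rewrite mulrCA [X in _ = X]mulrCA => /(mulfI (expf_neq0 _ (cis_neq0 _))) E'.
  have sz0 : sin_prod tz t = 0.
    have := congr1 (fun x => Im (x * kw^*)) E'.
    rewrite mulrAC [X in _ = Im X]mulrAC mulrC ImZ cis_cst_conj -rmorphM /=.
    by move/eqP; rewrite mulf_eq0 => /orP[/eqP //|/eqP /iota0].
  have Pz : P.[cis t] = 0 by rewrite horner_prod_cis sz0 mulr0.
  by apply: (@disjoint_zeros (cis t)); rewrite /root ?Pz -?E ?Pz.
(* Inside the disk follow [f] along the segment from 0 to z: its end values have opposite signs, so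
   it would vanish in between, against [ratio_not_real]. *)
pose h (t : R) := (P.[t%:C%C * z] / kz) * (Q.[t%:C%C * z] / kw)^*.
have fneq0 (y : C) : `|y| < 1 -> f y <> 0.
  by move=> y1; apply: ratio_not_real => y1'; move: y1; rewrite y1' ltxx.
have z01 : `|0 : C| < 1 by rewrite normr0.
have [||c /andP[c0 c1] hc] := @IVT_sign R (fun t => Im (h t)) 0 1 ler01.
- apply: continuous_Im_curve => t; eexists.
  have lin : curve_derive (fun t => t%:C%C * z) t (1 * z + t%:C%C * 0).
    apply: curve_deriveM; last exact: curve_derive_cst.
    split; [exact: is_derive_id | exact: is_derive_cst].
  apply: curve_deriveM.
    by apply: curve_deriveM; [exact: curve_derive_horner lin|exact: curve_derive_cst].
  apply: curve_derive_conj.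
  by apply: curve_deriveM; [exact: curve_derive_horner lin|exact: curve_derive_cst].
- have h0 : Im (h 0) = f 0 by rewrite /h rmorph0 mul0r.
  have h1 : Im (h 1) = f z by rewrite /h rmorph1 mul1r.
  have [b b0 Eb] := Im_ratio_eq E.
  rewrite h0 h1 lt_neqAle mulf_eq0; apply/andP; split.
    by apply/norP; split; apply/eqP; apply: fneq0.
  rewrite Im_ratio0 Eb mulrACA mulrN mulNr oppr_le0 -expr2.
  by rewrite mulr_ge0 ?sqr_ge0 // mulr_ge0 ?sqr_ge0.
apply: (fneq0 (c%:C%C * z)); last exact: hc.
rewrite normrM; apply: le_lt_trans z1; rewrite ler_piMl ?normr_ge0 //.
by rewrite normc_def /= expr0n addr0 sqrtr_sqr lecR gtr0_norm // ltW.
Qed.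

End Pencil.

(** * The converse: existence and uniqueness of the coefficients *)

Section Wendroff.
Variable R : realType.
Local Notation C := R[i].

(** For |z| = 1 the reversal 1 - z^* X of X - z is - z^* times X - z, and - z^* is the conjugate of
    its value at 0. *)
Lemma revp_prod_circle (s : seq C) : {in s, forall z, `|z| = 1} ->
  let P := \prod_(z <- s) ('X - z%:P) in revp (size s) P = (P.[0])^* *: P.
Proof.
rewrite /=; elim: s => [|z s IH] hs.
  by rewrite big_nil hornerC rmorph1 scale1r revp01.
rewrite big_cons revp_mulXsubC ?size_prod_XsubC // IH; last first.
  by move=> y ys; apply: hs; rewrite inE ys orbT.
have zz : z^* * z = 1 by rewrite mulrC -normCK hs ?mem_head // expr1n.
have -> : 1 - z^* *: 'X = - z^* *: ('X - z%:P).
  by rewrite scalerBr !scaleNr opprK -[_ *: z%:P]mul_polyC -polyCM zz addrC.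
rewrite hornerM hornerXsubC sub0r rmorphM rmorphN /=.
by rewrite -scalerAl -scalerAr scalerA.
Qed.

Lemma norm_prod_circle0 (s : seq C) : {in s, forall z, `|z| = 1} ->
  `|(\prod_(z <- s) ('X - z%:P)).[0]| = 1.
Proof.
move=> hs; rewrite horner_prod normr_prod big_seq big1 // => z zs.
by rewrite hornerXsubC sub0r normrN hs.
Qed.

Lemma monic_eq_prod_roots (P : {poly C}) (s : seq C) :
  P \is monic -> size P = (size s).+1 -> uniq s -> {in s, forall z, root P z} ->
  P = \prod_(z <- s) ('X - z%:P).
Proof.
move=> mP sP us rs; rewrite -[RHS]scale1r -(monicP mP).
apply: all_roots_prod_XsubC => //; first exact/allP.
by rewrite uniq_rootsE.
Qed.

Lemma opuc_of_products (n : nat) (sz sw : seq C) :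
  {in sz, forall z, `|z| = 1} -> {in sw, forall z, `|z| = 1} ->
  size sz = n.+1 -> size sw = n.+1 ->
  let P := \prod_(z <- sz) ('X - z%:P) in let Q := \prod_(z <- sw) ('X - z%:P) in
  (forall z, `|z| <= 1 -> P.[z] != Q.[z]) ->
  exists a : nat -> C, [/\ forall j, (j < n)%N -> `|a j| < 1,
    'X * opuc a n + P.[0] *: revp n (opuc a n) = P &
    'X * opuc a n + Q.[0] *: revp n (opuc a n) = Q].
Proof.
move=> hz hw sz1 sw1 P Q PQ.
have revP : revp n.+1 P = (P.[0])^* *: P by rewrite -sz1 revp_prod_circle.
have revQ : revp n.+1 Q = (Q.[0])^* *: Q by rewrite -sw1 revp_prod_circle.
have P1 : `|P.[0]| = 1 by apply: norm_prod_circle0.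
have Q1 : `|Q.[0]| = 1 by apply: norm_prod_circle0.
have conjV (x : C) : `|x| = 1 -> x^* = x^-1.
  by move=> x1; rewrite invC_norm x1 expr1n invr1 mul1r.
set p := P.[0] in revP P1 *; set q := Q.[0] in revQ Q1 *.
have d0 : p - q != 0 by rewrite subr_eq0 PQ // normr0 ler01.
have p0 : p != 0 by rewrite -normr_eq0 P1 oner_eq0.
have q0 : q != 0 by rewrite -normr_eq0 Q1 oner_eq0.
(* Subtracting the two desired equations leaves (p - q) Phi_n^* = P - Q, so [V] is the only choice
   for Phi_n^*. *)
pose V := (p - q)^-1 *: (P - Q).
have sV : (size V <= n.+1)%N.
  rewrite (leq_trans (size_scale_leq _ _)) //; apply/leq_sizeP => j.
  rewrite leq_eqVlt coefB => /orP[/eqP <-|nj].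
    have /monicP : P \is monic by apply: monic_prod_XsubC.
    have /monicP : Q \is monic by apply: monic_prod_XsubC.
    by rewrite !lead_coefE !size_prod_XsubC sz1 sw1 /= => -> ->; rewrite subrr.
  by rewrite !nth_default ?subrr // size_prod_XsubC ?sz1 ?sw1.
have V0 : V.[0] = 1 by rewrite hornerZ hornerD hornerN mulVf.
pose Phi := revp n V.
have revPhi : revp n Phi = V by rewrite revpK.
have Phin : Phi`_n = 1.
  by rewrite coef_revp leqnn subnn -horner_coef0 V0 rmorph1.
have sPhi : size Phi = n.+1.
  apply/eqP; rewrite eqn_leq size_revp ltnNge /=.
  by apply: contra_eqN Phin => /leq_sizeP -> //; rewrite eq_sym oner_eq0.
have mPhi : Phi \is monic by rewrite monicE lead_coefE sPhi /= Phin.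
(* Reversing [V] in degree n + 1 gives z Phi, while P and Q only pick up the factors 1 / p and 1 /
   q. *)
have XPhi : 'X * Phi = ((p - q)^-1)^* *: (p^-1 *: P - q^-1 *: Q).
  by rewrite -revpS // revpZ revpB revP revQ (conjV _ P1) (conjV _ Q1).
(* A zero of [Phi] with |z| >= 1 would reflect to a zero of P - Q in the closed disk. *)
have [z|a an Ea] := opuc_surj mPhi sPhi.
  move=> Phiz; rewrite real_ltNge ?normr_real ?real1 //; apply/negP => z1.
  have z0 : z != 0 by rewrite -normr_gt0 (lt_le_trans ltr01).
  move: Phiz; rewrite rootE horner_revp // mulf_eq0 expf_eq0 (negPf z0) andbF /=.
  rewrite conjC_eq0 hornerZ mulf_eq0 invr_eq0 (negPf d0) /= hornerD hornerN.
  rewrite subr_eq0 (negPf (PQ _ _)) // normfV norm_conjC invf_le1 //.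
  by rewrite (lt_le_trans ltr01).
exists a; rewrite Ea revPhi XPhi.
have d0' : q - p != 0 by rewrite -opprB oppr_eq0.
have -> : ((p - q)^-1)^* = p * q / (q - p).
  rewrite fmorphV rmorphB /= (conjV _ P1) (conjV _ Q1); have -> : p^-1 - q^-1 = (q - p) / (p * q).
    by field; rewrite p0 q0.
  by rewrite invf_div.
split=> //; apply/polyP => i; rewrite /V !(coefD, coefN, coefZ); field;
  by rewrite p0 q0 d0 d0'.
Qed.

(** Zero sets can be traded for polynomials because n + 1 distinct zeros determine a monic
    polynomial of degree n + 1. *)
Lemma popuc_seqP (n : nat) (alpha : n.-tuple C) (lam : C) (s : seq C) :
  (forall j : 'I_n, in_disk (tnth alpha j)) -> `|lam| = 1 -> uniq s ->
  size s = n.+1 -> (zeros (popuc alpha lam) = [set` s] <->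
  popuc alpha lam = \prod_(z <- s) ('X - z%:P)).
Proof.
move=> adisk lam1 us ss; split=> [E|->]; last first.
  by apply/seteqP; split=> z; rewrite /zeros /= root_prod_XsubC.
have [m sz] := monic_size_mulX_revp lam^* (monic_opuc (nth 0 alpha) n)
  (size_opuc (nth 0 alpha) n).
apply: monic_eq_prod_roots => //; first by rewrite ss.
by move=> z zs; have : zeros (popuc alpha lam) z by rewrite E.
Qed.

Lemma popuc0 (n : nat) (alpha : n.-tuple C) (lam : C) :
  (popuc alpha lam).[0] = - lam^*.
Proof.
rewrite /popuc hornerD hornerN hornerZ hornerM hornerX mul0r sub0r.
by rewrite revp_monic0 ?monic_opuc ?size_opuc ?mulr1.
Qed.

(** The parameters are read off at 0. The difference of the two POPUCs is then a nonzero multiple of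
    Phi_n^*, which determines Phi_n and so the coefficients. *)
Lemma popuc_inj (n : nat) (alpha beta : n.-tuple C) (lam mu nu xi : C) :
  (forall j : 'I_n, in_disk (tnth alpha j)) ->
  (forall j : 'I_n, in_disk (tnth beta j)) -> lam != mu ->
  popuc alpha lam = popuc beta nu -> popuc alpha mu = popuc beta xi ->
  [/\ alpha = beta, lam = nu & mu = xi].
Proof.
move=> da db lamu E1 E2.
have El : lam = nu.
  by apply/(can_inj (@conjCK C))/oppr_inj; rewrite -(popuc0 alpha) E1 popuc0.
have Em : mu = xi.
  by apply/(can_inj (@conjCK C))/oppr_inj; rewrite -(popuc0 alpha) E2 popuc0.
split=> //; move: E1 E2; rewrite -{}El -{}Em /popuc.
set a := nth 0 alpha; set b := nth 0 beta => E1 E2.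
have dl : mu^* - lam^* != 0.
  by rewrite subr_eq0 (inj_eq (can_inj (@conjCK C))) eq_sym.
have E : revp n (opuc a n) = revp n (opuc b n).
  apply: (scalerI dl); rewrite !scalerBl.
  have h (u v : {poly C}) : mu^* *: v - lam^* *: v = (u - lam^* *: v) - (u - mu^* *: v).
    by rewrite opprB [RHS]addrC addrA subrK.
  by rewrite (h ('X * opuc a n)) E1 E2 -h.
have {}E : opuc a n = opuc b n.
  by rewrite -[LHS](@revpK _ n) ?size_opuc // E revpK ?size_opuc.
apply: eq_from_tnth => j; rewrite !(tnth_nth 0).
apply: (opuc_inj _ _ E) => // i ilt.
  by have := da (Ordinal ilt); rewrite /in_disk (tnth_nth 0).
by have := db (Ordinal ilt); rewrite /in_disk (tnth_nth 0).
Qed.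

Lemma interlace_popuc (n : nat) (Z W : set C) : interlace n.+1 Z W ->
  exists! p : n.-tuple C * C * C,
    let: (alpha, lam, mu) := p in
    [/\ forall j : 'I_n, in_disk (tnth alpha j),
        unit_circle lam, unit_circle mu,
        Z = zeros (popuc alpha lam) & W = zeros (popuc alpha mu)].
Proof.
move=> ZW; have [[Z1 W1] [cZ cW] _ _] := ZW.
have [sz [uz ssz EZ]] := (card_eq_uniq_seqP Z n.+1).1 cZ.
have [sw [uw ssw EW]] := (card_eq_uniq_seqP W n.+1).1 cW.
have hz : {in sz, forall z, `|z| = 1}.
  by move=> z zs; have : Z z by [rewrite EZ]; apply: Z1.
have hw : {in sw, forall z, `|z| = 1}.
  by move=> z zs; have : W z by [rewrite EW]; apply: W1.
have PQ z : `|z| <= 1 ->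
    (\prod_(z <- sz) ('X - z%:P)).[z] != (\prod_(z <- sw) ('X - z%:P)).[z].
  have [tz Etz] := seq_cis hz; have [tw Etw] := seq_cis hw.
  have stz : size tz = n.+1 by rewrite -ssz Etz size_map.
  have stw : size tw = size tz by rewrite stz -ssw Etw size_map.
  rewrite Etz Etw; apply: horner_neq_disk => //; rewrite -?Etz -?Etw //.
    by rewrite stz -EZ -EW.
  by rewrite -size_eq0 stz.
have [a [an EP EQ]] := opuc_of_products hz hw ssz ssw PQ.
set P := \prod_(z <- sz) _ in EP PQ; set Q := \prod_(z <- sw) _ in EQ PQ.
pose alpha := [tuple a j | j < n].
have Ea : opuc (nth 0 alpha) n = opuc a n.
  apply: eq_opuc => j jn.
  by rewrite -(tnth_nth 0 alpha (Ordinal jn)) tnth_mktuple.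
have adisk (j : 'I_n) : in_disk (tnth alpha j).
  by rewrite tnth_mktuple; apply: an.
(* By [popuc0] the parameters must be minus the conjugates of P(0) and Q(0). *)
have P1 : `|- (P.[0])^*| = 1 by rewrite normrN norm_conjC norm_prod_circle0.
have Q1 : `|- (Q.[0])^*| = 1 by rewrite normrN norm_conjC norm_prod_circle0.
have pP : popuc alpha (- (P.[0])^*) = P.
  by rewrite /popuc Ea rmorphN /= conjCK scaleNr opprK.
have pQ : popuc alpha (- (Q.[0])^*) = Q.
  by rewrite /popuc Ea rmorphN /= conjCK scaleNr opprK.
exists (alpha, - (P.[0])^*, - (Q.[0])^*); split.
  split=> //; [rewrite EZ|rewrite EW]; apply/esym/popuc_seqP => //.
move=> [[beta nu] xi] [bdisk nu1 xi1 Znu Wxi].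
have E1 : popuc alpha (- (P.[0])^*) = popuc beta nu.
  by rewrite pP; apply/esym/popuc_seqP => //; rewrite -Znu.
have E2 : popuc alpha (- (Q.[0])^*) = popuc beta xi.
  by rewrite pQ; apply/esym/popuc_seqP => //; rewrite -Wxi.
have PQ0 : - (P.[0])^* != - (Q.[0])^*.
  rewrite eqr_opp (inj_eq (can_inj (@conjCK C))).
  by apply: PQ; rewrite normr0 ler01.
by have [-> -> ->] := popuc_inj adisk bdisk PQ0 E1 E2.
Qed.

End Wendroff.

Theorem theorem8 (R : realType) (n : nat) (hn : (1 <= n)%N) :
  (forall (alpha : n.-tuple R[i]) (lam mu : R[i]),
      (forall j : 'I_n, in_disk (tnth alpha j)) ->
      unit_circle lam -> unit_circle mu -> lam <> mu ->
      interlace n.+1 (zeros (popuc alpha lam)) (zeros (popuc alpha mu)))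
  /\
  (forall Z W : set R[i],
      interlace n.+1 Z W ->
      exists! p : n.-tuple R[i] * R[i] * R[i],
        let: (alpha, lam, mu) := p in
        [/\ forall j : 'I_n, in_disk (tnth alpha j),
            unit_circle lam, unit_circle mu,
            Z = zeros (popuc alpha lam) & W = zeros (popuc alpha mu)]).
Proof.
split=> *; [exact: popuc_interlace|exact: interlace_popuc].
Qed.
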